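(* Let $K$ be a field of characteristic zero, $R=K[x,y,z]$, $s\ge 3$, and let $I=(L_1^{a_1},\dots,L_s^{a_s})$, where $L_1,\dots,L_s$ are general linear forms and $a_1,\dots,a_s$ are positive integers. Let $L$ be a general linear form. Then for every integer $j$ the homomorphism $\times L^2:[R/I]_{j-2}\to[R/I]_j$ has maximal rank (i.e. is injective or surjective).
   Context: ''General'' means in a suitable nonempty Zariski open set. *)

(* Defs.v *)
From HB Require Import structures.
From mathcomp Require Import all_boot all_order all_algebra.
From mathcomp Require Import mpoly.
Set Implicit Arguments. Unset Strict Implicit. Unset Printing Implicit Defensive.
Import Order.TTheory GRing.Theory Num.Theory.
Local Open Scope ring_scope.

Section Defs.
Variable K : fieldType.

Definition zariski_open (n : nat) (U : ('I_n -> K) -> Prop) : Prop :=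
  exists S : {mpoly K[n]} -> Prop,
    forall v, U v <-> exists2 f, S f & f.@[v] != 0.

Definition general (n : nat) (P : ('I_n -> K) -> Prop) : Prop :=
  exists U : ('I_n -> K) -> Prop,
    [/\ zariski_open U, exists v, U v & forall v, U v -> P v].

Definition linform (c : 'I_3 -> K) : {mpoly K[3]} := \sum_(k < 3) c k *: 'X_k.

Definition in_ideal (s : nat) (G : 'I_s -> {mpoly K[3]}) (f : {mpoly K[3]}) : Prop :=
  exists g : 'I_s -> {mpoly K[3]}, f = \sum_(i < s) g i * G i.

Definition homog_deg (d : int) (f : {mpoly K[3]}) : Prop :=
  match d with
  | Posz m => f \is m.-homog
  | Negz _ => f = 0
  end.

(* The map  x M : [R/I]_(j-deg M) -> [R/I]_j, where I = (G), [R/I]_d = R_d / I_d,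
   I_d = I ∩ R_d. *)
Definition mult_injective s (G : 'I_s -> {mpoly K[3]}) (M : {mpoly K[3]}) (e j : int) :=
  forall f, homog_deg (j - e) f -> in_ideal G (M * f) -> in_ideal G f.

Definition mult_surjective s (G : 'I_s -> {mpoly K[3]}) (M : {mpoly K[3]}) (e j : int) :=
  forall h, homog_deg j h ->
    exists2 f, homog_deg (j - e) f & in_ideal G (h - M * f).

Definition mult_maximal_rank s G M e j :=
  @mult_injective s G M e j \/ @mult_surjective s G M e j.

End Defs.

(* Main.v *)
Require Import Defs.
From HB Require Import structures.
From mathcomp Require Import all_boot all_order all_algebra.
From mathcomp Require Import mpoly.
From mathcomp Require Import ring zify.
Import GRing.Theory.
Local Open Scope ring_scope.

(** Idea. If the map (g_i) |-> sum_i g_i L_i^{a_i} from the sum of the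
    (R/L^2)_{j - a_i} to (R/L^2)_j is injective (resp. surjective), then so is
    multiplication by L^2 from [R/I]_{j-2} to [R/I]_j.  Having maximal rank is
    a Zariski open condition, so for each j one good point is enough.  Take
    L = z and L_i = x + t_i y + c_i z.  By apolarity, a functional on (R/z^2)_j
    killing the image is a polynomial F(t) + w G(t), with deg F <= j and
    deg G <= j - 1, vanishing at (t_i, c_i) to order d_i + 1, where
    d_i = j - a_i.  Then prod_i (t - t_i)^{d_i} divides F and G, and the two
    quotients f, g satisfy f(t_i) + c_i g(t_i) = 0.  Choosing
    c_i = t_i^{eps + 1}, with eps = j - sum_i d_i >= deg f, makes this the
    vanishing of the one-variable polynomial f + X^{eps + 1} g at the t_i, so
    the conditions are independent.  Finitely many j suffice, as surjectivity
    in degree j implies surjectivity in degree j + 1. *)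

Set Implicit Arguments. Unset Strict Implicit. Unset Printing Implicit Defensive.

(** * Fat points on a double line *)

(** In the Taylor expansion of [p] at [t] by Hasse derivatives, the terms of order below [n] vanish
    and the others are multiples of the power. *)
Lemma dvdp_exp_XsubC_nderivn (K : fieldType) (p : {poly K}) (t : K) (n : nat) :
  (forall r, (r < n)%N -> p^`N(r).[t] = 0) -> ('X - t%:P) ^+ n %| p.
Proof.
move=> pt0.
have -> : p = \sum_(r < size p) p^`N(r).[t] *: ('X - t%:P) ^+ r.
  rewrite -[LHS]comp_polyXr -{1}['X](subrK t%:P) addrC comp_polyE.
  rewrite -[p in RHS]/(p).
  (* The point [t + ('X - t)] lies in [{poly K}], so Taylor's formula is applied to [p] with its
     coefficients lifted there. *)
  have := @nderiv_taylor _ (map_poly polyC p) t%:P ('X - t%:P) (mulrC _ _).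
  rewrite horner_poly ?size_map_polyC => E.
  transitivity ((map_poly polyC p).[t%:P + ('X - t%:P)]).
    rewrite horner_coef size_map_polyC; apply: eq_bigr => i _.
    by rewrite coef_map /= mul_polyC.
  rewrite nderiv_taylor ?size_map_polyC; last exact: mulrC.
  by apply: eq_bigr => i _; rewrite nderivn_map horner_map /= mul_polyC.
apply: (big_ind (fun q => _ %| q)); first exact: dvdp0.
  by move=> x y; exact: dvdp_add.
move=> r _; case: (ltnP r n) => [/pt0->|le_nr]; first by rewrite scale0r dvdp0.
by rewrite -mul_polyC; apply: dvdp_mull; apply: dvdp_exp2l.
Qed.

Lemma dvdp_prod_exp_XsubC (K : fieldType) (I : finType) (P : pred I) (t : I -> K)
    (d : I -> nat) (p : {poly K}) :
  injective t -> (forall i, P i -> ('X - (t i)%:P) ^+ d i %| p) ->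
  \prod_(i | P i) ('X - (t i)%:P) ^+ d i %| p.
Proof.
move=> tI; rewrite -big_enum /=.
have : forall i, i \in enum P -> P i by move=> i; rewrite mem_enum.
elim: (enum P) (enum_uniq P) => [|i e IH] /=; first by rewrite big_nil dvd1p.
move=> /andP[ie ue] eP dP; rewrite big_cons Gauss_dvdp.
  rewrite dP ?eP ?mem_head //=; apply: IH => // k ke.
  by apply: eP; rewrite inE ke orbT.
rewrite big_seq; apply: (big_ind (fun q => coprimep _ q)); first exact: coprimep1.
  by move=> x y; rewrite coprimepMr => -> ->.
move=> k ke; apply: coprimep_expl; apply: coprimep_expr.
rewrite coprimep_XsubC root_XsubC; apply: contra ie => /eqP/tI kE.
by rewrite -kE ke || rewrite kE ke.
Qed.

(** Coefficientwise this is [C(n,k) C(k,r) = C(n,r) C(n-r,k-r)]. It translates vanishing orders of a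
    generating polynomial into values of the functional [g] on [X^r (1 + tX)^(n-r)]. *)
Lemma horner_nderivn_binomial (K : fieldType) (g : nat -> K) (n r : nat) (t : K) :
  (r <= n)%N ->
  (\poly_(k < n.+1) (g k *+ 'C(n, k)))^`N(r).[t] =
  (\sum_(k < n.+1) g k * ('X^r * (1 + t *: 'X) ^+ (n - r))`_k) *+ 'C(n, r).
Proof.
move=> le_rn; rewrite poly_def linear_sum horner_sum -sumrMnl.
apply: eq_bigr => -[k /= lt_kn] _.
rewrite linearZ /= nderivnXn hornerZ hornerMn hornerXn coefXnM.
case: ltnP => [lt_kr|le_rk]; first by rewrite (bin_small lt_kr) mulr0n !mulr0 mul0rn.
rewrite exprDn coef_sum.
have lt_krn : (k - r < (n - r).+1)%N by lia.
rewrite (bigD1 (Ordinal lt_krn)) //= big1 => [|i /eqP/val_eqP /= nei].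
  rewrite addr0 expr1n mul1r exprZn coefMn coefZ coefXn eqxx mulr1.
  rewrite mulrnAl !mulrnAr -!mulrnA; congr (_ *+ _).
  rewrite -[k in LHS](subnKC le_rk) -[n in LHS](subnKC le_rn).
  have := bin_fact le_rn; have := bin_fact le_rk.
  have le_kn : (k <= n)%N by lia.
  have := bin_fact le_kn; have le_knr : (k - r <= n - r)%N by lia.
  have := bin_fact le_knr.
  rewrite (subnKC le_rk) (subnKC le_rn).
  have -> : (n - r - (k - r) = n - k)%N by lia.
  move: (fact_gt0 r) (fact_gt0 (k - r)) (fact_gt0 (n - k)) (fact_gt0 k) (fact_gt0 (n - r)).
  move: (r`!) ((k - r)`!) ((n - k)`!) (k`!) ((n - r)`!) (n`!) => a b c e f h.
  move: 'C(n, k) 'C(k, r) 'C(n, r) 'C(n - r, k - r) => w x y z.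
  move=> a0 b0 c0 e0 f0 E1 E2 E3 E4.
  apply/eqP; rewrite -(eqn_pmul2r (m := (a * b * c)%N)) ?muln_gt0 ?a0 ?b0 //; apply/eqP.
  transitivity h; first by rewrite -E2 -E3; ring.
  by rewrite -E4 -E1; ring.
by rewrite expr1n mul1r exprZn coefMn coefZ coefXn eq_sym (negPf nei) mulr0 mul0rn.
Qed.
(** A functional on binary forms of degree [n - 1], dehomogenized by [x = 1]. *)
Definition cpair (K : fieldType) (f : nat -> K) (n : nat) (p : {poly K}) : K :=
  \sum_(k < n) f k * p`_k.

Lemma mulrn_pchar0_eq0 (K : fieldType) (hK : [pchar K] =i pred0) (x : K) (n : nat) :
  (x *+ n == 0) = (n == 0) || (x == 0).
Proof. by rewrite -mulr_natr mulf_eq0 orbC; move/pcharf0P: hK => ->. Qed.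

Lemma size_Xn_linear_exp (K : fieldType) (t : K) (r e : nat) :
  (size ('X^r * (1 + t *: 'X) ^+ e : {poly K})%R <= (r + e).+1)%N.
Proof.
apply: leq_trans (size_polyMleq _ _) _; rewrite size_polyXn addSn /= -addnS leq_add2l.
apply: leq_trans (size_poly_exp_leq _ _) _.
have : (size (1 + t *: 'X : {poly K})%R <= 2)%N.
    apply: leq_trans (size_polyD _ _) _; rewrite size_poly1 geq_max /=.
    by apply: leq_trans (size_scale_leq _ _) _; rewrite size_polyX.
  by case: (size _) => [|[|[|]]] //= _; lia.
Qed.

Lemma size_divisor_quot (K : fieldType) (k q : {poly K}) (e n : nat) :
  size q = e.+1 -> (size (k * q)%R <= n)%N -> (size k <= n - e)%N.
Proof.
move=> sq; have [->|k0] := eqVneq k 0; first by rewrite size_poly0.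
have q0 : q != 0 by rewrite -size_poly_eq0 sq.
by rewrite size_mul // sq addnS /= => /(leq_sub2r e); rewrite addnK.
Qed.

Lemma size_prod_exp_XsubC (K : fieldType) (I : finType) (P : pred I) (t : I -> K)
    (d : I -> nat) :
  size (\prod_(i | P i) ('X - (t i)%:P) ^+ d i) = (\sum_(i | P i) d i)%N.+1.
Proof.
elim/big_rec2: _ => [|i n q _ IH]; first by rewrite size_poly1.
rewrite size_mul ?size_exp_XsubC ?IH ?addnS //.
  by rewrite expf_neq0 // polyXsubC_eq0.
by rewrite -size_poly_eq0 IH.
Qed.

Section FatPoints.
Variables (K : fieldType) (hK : [pchar K] =i pred0).
Variables (I : finType) (P : pred I) (t : I -> K) (d : I -> nat) (m : nat).
Variables (al be : nat -> K).
Hypothesis tI : injective t.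
Hypothesis dm : forall i, P i -> (d i <= m)%N.
Let D := (\sum_(i | P i) d i)%N.
Let eps := (m.+1 - D)%N.
Hypothesis hc : (m.+1 < D)%N \/ (eps.*2 < #|P|)%N.
(** With [x = 1], [H1] and [H2] say that the functional kills [p l^a] and [z p l^a] modulo [z^2],
    where [l = x + t_i y + c z], [c = t_i^(eps+1)] and [a = m + 1 - d_i]; modulo [z^2], [l^a] is
    [(x + t_i y)^a + a c z (x + t_i y)^(a-1)]. *)
Hypothesis H1 : forall i, P i -> forall p : {poly K}, (size p <= (d i).+1)%N ->
  cpair al m.+2 (p * (1 + t i *: 'X) ^+ (m.+1 - d i)) +
  t i ^+ eps.+1 * cpair be m.+1 (p * (1 + t i *: 'X) ^+ (m - d i)) *+ (m.+1 - d i) = 0.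
Hypothesis H2 : forall i, P i -> forall p : {poly K}, (size p <= d i)%N ->
  cpair be m.+1 (p * (1 + t i *: 'X) ^+ (m.+1 - d i)) = 0.

(* The generating polynomials of the functional: F(t) is its value on (x + ty)^j
   and G(t) its value on z (x + ty)^(j - 1), where j = m + 1. *)
Let F := \poly_(k < m.+2) (al k *+ 'C(m.+1, k)).
Let G := \poly_(k < m.+1) (be k *+ 'C(m, k)).
Let Q := \prod_(i | P i) ('X - (t i)%:P) ^+ d i.

(** This is [H2] at [p = X^r (1 + t_i X)^(d_i-1-r)]. Up to a binomial factor the left side is a
    Hasse derivative of [G] at [t i]. *)
Lemma nderivn_G i r : P i -> (r < d i)%N ->
  cpair be m.+1 ('X^r * (1 + t i *: 'X) ^+ (m - r)) = 0.
Proof.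
move=> Pi rd; have dm' := dm Pi.
have -> : (m - r = (d i).-1 - r + (m.+1 - d i))%N by lia.
rewrite exprD mulrA; apply: H2 => //.
by apply: leq_trans (size_Xn_linear_exp _ _ _) _; lia.
Qed.

(** This is [H1] at [p = X^r (1 + t_i X)^(d_i-r)]. The order [r = d i] is included; there the term
    in [be] may survive. *)
Lemma nderivn_F i r : P i -> (r <= d i)%N ->
  cpair al m.+2 ('X^r * (1 + t i *: 'X) ^+ (m.+1 - r)) =
  - (t i ^+ eps.+1 * cpair be m.+1 ('X^r * (1 + t i *: 'X) ^+ (m - r)) *+ (m.+1 - d i)).
Proof.
move=> Pi rd; have dm' := dm Pi.
have := @H1 i Pi ('X^r * (1 + t i *: 'X) ^+ (d i - r)) _.
rewrite -!mulrA -!exprD.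
have -> : (d i - r + (m.+1 - d i) = m.+1 - r)%N by lia.
have -> : (d i - r + (m - d i) = m - r)%N by lia.
move=> E; apply/eqP; rewrite -addr_eq0 E //.
by apply: leq_trans (size_Xn_linear_exp _ _ _) _; lia.
Qed.

Lemma dvdp_QG : Q %| G.
Proof.
apply: dvdp_prod_exp_XsubC => // i Pi; apply: dvdp_exp_XsubC_nderivn => r rd.
have dm' := dm Pi; rewrite horner_nderivn_binomial; last by lia.
by have := nderivn_G Pi rd; rewrite /cpair => ->; rewrite mul0rn.
Qed.

Lemma dvdp_QF : Q %| F.
Proof.
apply: dvdp_prod_exp_XsubC => // i Pi; apply: dvdp_exp_XsubC_nderivn => r rd.
have dm' := dm Pi; rewrite horner_nderivn_binomial; last by lia.
have := nderivn_F Pi (ltnW rd); rewrite (nderivn_G Pi rd) /cpair => ->.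
by rewrite mulr0 mul0rn oppr0 mul0rn.
Qed.

(** With [c = t i ^+ eps.+1] fixed, the right side is, as a polynomial in [t], the value of the
    functional on [(x + ty + cz)^(m+1)] modulo [z^2]. It gains one order of vanishing over [F] and
    [G]. *)
Lemma dvdp_FG i : P i ->
  ('X - (t i)%:P) ^+ (d i).+1 %| F + t i ^+ eps.+1 *: (G *+ m.+1).
Proof.
move=> Pi; apply: dvdp_exp_XsubC_nderivn => r; rewrite ltnS => rd.
have dm' := dm Pi.
rewrite linearD linearZ linearMn /= hornerD hornerZ hornerMn.
rewrite !horner_nderivn_binomial; try by lia.
have := nderivn_F Pi rd; rewrite /cpair => ->.
move: rd; rewrite leq_eqVlt => /orP[/eqP->|rd].
  (* At order [d i] the two terms cancel by [(m+1) C(m,d_i) = (m+1-d_i) C(m+1,d_i)]. *)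
  have := mul_bin_down m.+1 (d i) => /= E.
  by rewrite mulNrn -!mulrnA -E mulnC -mulrnAr addNr.
by have := nderivn_G Pi rd; rewrite /cpair => ->;
  rewrite !(mulr0, mul0rn) oppr0 !(mulr0, mul0rn) addr0.
Qed.

Lemma fat_points_functional_eq0 :
  (forall k, (k <= m.+1)%N -> al k = 0) /\ (forall k, (k <= m)%N -> be k = 0).
Proof.
have /dvdpP[f fE] := dvdp_QF; have /dvdpP[g gE] := dvdp_QG.
have sQ : size Q = D.+1 by exact: size_prod_exp_XsubC.
have Q0 : Q != 0 by rewrite -size_poly_eq0 sQ.
have sf : (size f <= m.+2 - D)%N.
  by apply: size_divisor_quot sQ _; rewrite -fE size_poly.
have sg : (size g <= m.+1 - D)%N.
  by apply: size_divisor_quot sQ _; rewrite -gE size_poly.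
have [f0 g0] : f = 0 /\ g = 0.
  case: hc => [lt_mD|lt_eP].
    by split; apply/eqP; rewrite -size_poly_leq0; lia.
  have [lt_mD|le_Dm] := ltnP m.+1 D.
    by split; apply/eqP; rewrite -size_poly_leq0; lia.
  (* Here [f] fills degrees up to [eps] and the shifted [g] degrees [eps + 1] to [2 eps]. So [h] has
     degree at most [2 eps], with no overlap; more than [2 eps] roots [t i] force [h = 0], hence
     [f = g = 0]. *)
  pose h := f + 'X^(eps.+1) * (g *+ m.+1).
  have h0 : h = 0.
    apply/eqP; apply: contraLR lt_eP => hn0; rewrite -leqNgt cardE.
    rewrite -(size_map t) -ltnS.
    have sh : (size h <= eps.*2.+1)%N.
      apply: leq_trans (size_polyD _ _) _; rewrite geq_max; apply/andP; split.
        by rewrite /eps; lia.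
      apply: leq_trans (size_polyMleq _ _) _; rewrite size_polyXn -mulr_natl.
      have : (size (m.+1%:R * g)%R <= size g)%N.
        by rewrite mulr_natl -scaler_nat size_scale_leq.
      by rewrite /eps; lia.
    apply: leq_trans sh; apply: max_poly_roots => //; last first.
      by rewrite map_inj_uniq // enum_uniq.
    apply/allP => _ /mapP[i + ->]; rewrite mem_enum => Pi.
    have := dvdp_FG Pi; rewrite fE gE.
    (* After cancelling [('X - t_i)^(d_i)] one factor ['X - t_i] is left. It does not divide [Qi],
       so the other factor vanishes at [t i], where its value is that of [h]. *)
    pose Qi := \prod_(k | P k && (k != i)) ('X - (t k)%:P) ^+ d k.
    have -> : Q = ('X - (t i)%:P) ^+ d i * Qi by rewrite /Q (bigD1 i).
    have -> (c : K) (x : {poly K}) : f * (x * Qi) + c *: ((g * (x * Qi)) *+ m.+1) =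
       x * ((f + c *: (g *+ m.+1)) * Qi).
      by rewrite -mulrnAl -!mul_polyC; move: (g *+ m.+1) => y; ring.
    rewrite exprSr dvdp_mul2l; last by rewrite expf_neq0 // polyXsubC_eq0.
    rewrite dvdp_XsubCl rootM => /orP[|].
      by rewrite /root !(hornerE, hornerMn).
    rewrite /root horner_prod; move/eqP => E; exfalso; move/eqP: E; apply/negP.
    apply/prodf_neq0 => k /andP[_ ki].
    by rewrite !hornerE expf_neq0 // subr_eq0; apply: contra ki => /eqP/tI->.
  split; apply/polyP => n; rewrite coef0.
    have [le_sn|lt_ns] := leqP (size f) n; first by rewrite nth_default.
    have := congr1 (fun p : {poly K} => p`_n) h0.
    rewrite coefD coefXnM coef0; case: ltnP => [_|]; first by rewrite addr0.
    by rewrite /eps; lia.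
  have := congr1 (fun p : {poly K} => p`_(n + eps.+1)) h0.
  rewrite coefD coefXnM coef0 ltnNge leq_addl /= addnK coefMn nth_default ?add0r.
    by move/eqP; rewrite mulrn_pchar0_eq0 // => /eqP.
  by apply: leq_trans sf _; rewrite /eps; lia.
have F0 : F = 0 by rewrite fE f0 mul0r.
have G0 : G = 0 by rewrite gE g0 mul0r.
(* The coefficients are the values of the functional times binomials, which are nonzero in
   characteristic zero. *)
split=> k le_k.
  have := congr1 (fun p : {poly K} => p`_k) F0; rewrite coef_poly ltnS le_k coef0.
  by move/eqP; rewrite mulrn_pchar0_eq0 // -leqn0 leqNgt bin_gt0 le_k => /eqP.
have := congr1 (fun p : {poly K} => p`_k) G0; rewrite coef_poly ltnS le_k coef0.
by move/eqP; rewrite mulrn_pchar0_eq0 // -leqn0 leqNgt bin_gt0 le_k => /eqP.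
Qed.
End FatPoints.

(** * General points *)

Section General.
Variables (K : fieldType) (hK : [pchar K] =i pred0).

Lemma natr_inj_pchar0 : injective (fun n : nat => n%:R : K).
Proof.
move=> n1 n2 /eqP E; apply/eqP; move: E.
wlog le12 : n1 n2 / (n1 <= n2)%N => [W|].
  by case/orP: (leq_total n1 n2) => /W // W' E; rewrite eq_sym W' // eq_sym.
rewrite eq_sym -subr_eq0 -natrB //; move/pcharf0P: hK => ->.
by rewrite subn_eq0 => le21; rewrite eqn_leq le12.
Qed.

Lemma exists_nonroot (p : {poly K}) : p != 0 -> exists x, p.[x] != 0.
Proof.
move=> p0; pose s : seq K := [seq n%:R | n <- iota 0 (size p)].
have us : uniq s by rewrite (map_inj_uniq natr_inj_pchar0) iota_uniq.
have [/(max_poly_roots p0)/(_ us)|] := boolP (all (root p) s).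
  by rewrite size_map size_iota ltnn.
by case/allPn => x _ px; exists x.
Qed.

(** A nonempty open set contains a nonempty principal one: take a member of the family not vanishing
    at the given point. *)
Lemma general_polyP (n : nat) (P : ('I_n -> K) -> Prop) :
  general P <-> exists D : {mpoly K[n]},
    (exists v, D.@[v] != 0) /\ (forall v, D.@[v] != 0 -> P v).
Proof.
split=> [[U [[S US] [v Uv] UP]]|[D [[v Dv] DP]]].
  have [f Sf fv] := (US v).1 Uv; exists f; split; first by exists v.
  by move=> w fw; apply/UP/US; exists f.
exists (fun w => D.@[w] != 0); split => //; last by exists v.
by exists (fun f => f = D) => w; split=> [Dw|[f ->]//]; exists D.
Qed.

(** Nonempty principal open sets meet: restrict both polynomials to the line through [v] and [w].
    The restrictions are nonzero, at parameters 0 and 1 respectively, so their product has a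
    non-root. *)
Lemma general_and (n : nat) (P Q : ('I_n -> K) -> Prop) :
  general P -> general Q -> general (fun v => P v /\ Q v).
Proof.
move=> /general_polyP[D [[v Dv] DP]] /general_polyP[E [[w Ew] EQ]].
apply/general_polyP; exists (D * E); split; last first.
  by move=> u; rewrite mevalM mulf_eq0 negb_or => /andP[/DP ? /EQ].
pose line (f : {mpoly K[n]}) : {poly K} :=
  mmap polyC (fun i => (v i)%:P + (w i - v i) *: 'X) f.
have lineE f x : (line f).[x] = f.@[fun i => v i + (w i - v i) * x].
  rewrite /line /mmap mevalE horner_sum; apply: eq_bigr => m _.
  rewrite hornerCM; congr (_ * _); rewrite /mmap1 horner_prod.
  by apply: eq_bigr => i _; rewrite !hornerE.
have [x] : exists x, (line D * line E).[x] != 0.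
  apply: exists_nonroot; rewrite mulf_neq0 //.
    apply: contra Dv => /eqP L0; have := lineE D 0; rewrite L0 horner0 => E0.
    by rewrite -[X in X == _](_ : 0 = _) // E0; apply: meval_eq => i; rewrite mulr0 addr0.
  apply: contra Ew => /eqP L0; have := lineE E 1; rewrite L0 horner0 => E0.
  by rewrite -[X in X == _](_ : 0 = _) // E0; apply: meval_eq => i; rewrite mulr1 addrC subrK.
by rewrite hornerM !lineE -mevalM => h; eexists; exact: h.
Qed.

Lemma general_true (n : nat) : general (fun _ : 'I_n -> K => True).
Proof.
apply/general_polyP; exists 1; split => //.
by exists (fun _ => 0); rewrite meval1 oner_eq0.
Qed.

Lemma general_imp (n : nat) (P Q : ('I_n -> K) -> Prop) :
  (forall v, P v -> Q v) -> general P -> general Q.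
Proof. by move=> PQ [U [oU eU UP]]; exists U; split=> // v /UP/PQ. Qed.

Lemma general_forall_lt (n : nat) (P : nat -> ('I_n -> K) -> Prop) (N : nat) :
  (forall k, (k < N)%N -> general (P k)) ->
  general (fun v => forall k, (k < N)%N -> P k v).
Proof.
elim: N => [_|N IH gP]; first by apply: general_imp (@general_true n).
have gN := gP N (ltnSn N); have gl := IH (fun k lk => gP k (ltnW lk)).
apply: general_imp (general_and gl gN) => v [Pl PN] k; rewrite ltnS leq_eqVlt.
by case/orP => [/eqP->//|/Pl].
Qed.

Lemma general_neq0 (n : nat) (D : {mpoly K[n]}) (v : 'I_n -> K) :
  D.@[v] != 0 -> general (fun w => D.@[w] != 0).
Proof. by move=> Dv; apply/general_polyP; exists D; split=> //; exists v. Qed.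

(* Full rank is an open condition: some maximal minor does not vanish. *)
Lemma general_row_full (n p q : nat) (M : 'M[{mpoly K[n]}]_(p, q)) (v : 'I_n -> K) :
  row_full (map_mx (meval v) M) -> general (fun w => row_full (map_mx (meval w) M)).
Proof.
move=> fM; pose f := fullrankfun fM.
have detE w : (\det (rowsub f M)).@[w] = \det (rowsub f (map_mx (meval w) M)).
  by rewrite -det_map_mx map_mxsub.
apply: general_imp (general_neq0 (D := \det (rowsub f M)) (v := v) _) => [w|].
  rewrite detE -unitfE -unitmxE -row_full_unit => fw.
  by rewrite -sub1mx (submx_trans _ (rowsub_sub f _)) // sub1mx.
by rewrite detE -unitfE -unitmxE fullrowsub_unit.
Qed.
End General.

(** * Binary forms in three variables *)

Definition ox : 'I_3 := Ordinal (isT : (0 < 3)%N).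
Definition oy : 'I_3 := Ordinal (isT : (1 < 3)%N).
Definition oz : 'I_3 := Ordinal (isT : (2 < 3)%N).

Lemma ord3P (i : 'I_3) : [\/ i = ox, i = oy | i = oz].
Proof.
by case: i => [[|[|[|//]]] h]; [apply: Or31|apply: Or32|apply: Or33]; apply: val_inj.
Qed.

Lemma linformE (K : fieldType) (c : 'I_3 -> K) :
  linform c = c ox *: 'X_ox + c oy *: 'X_oy + c oz *: 'X_oz.
Proof.
rewrite /linform !big_ord_recl big_ord0 addr0 addrA.
by congr (c _ *: 'X_ _ + c _ *: 'X_ _ + c _ *: 'X_ _); apply: val_inj.
Qed.

Definition xyz (a b c : nat) : 'X_{1..3} := [multinom nth 0%N [:: a; b; c] i | i < 3].

Lemma xyzx a b c : xyz a b c ox = a. Proof. by rewrite mnmE. Qed.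
Lemma xyzy a b c : xyz a b c oy = b. Proof. by rewrite mnmE. Qed.
Lemma xyzz a b c : xyz a b c oz = c. Proof. by rewrite mnmE. Qed.
Definition xyzE := (xyzx, xyzy, xyzz).

Lemma xyz_eta (m : 'X_{1..3}) : m = xyz (m ox) (m oy) (m oz).
Proof. by apply/mnmP => i; case: (ord3P i) => ->; rewrite xyzE. Qed.

Lemma xyz_eq a b c a' b' c' :
  (xyz a b c == xyz a' b' c') = [&& a == a', b == b' & c == c'].
Proof.
apply/eqP/and3P => [E|[/eqP-> /eqP-> /eqP->]//]; split; apply/eqP.
- by rewrite -(xyzx a b c) E xyzE.
- by rewrite -(xyzy a b c) E xyzE.
- by rewrite -(xyzz a b c) E xyzE.
Qed.

Lemma xyzD a b c a' b' c' :
  (xyz a b c + xyz a' b' c')%MM = xyz (a + a') (b + b') (c + c').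
Proof. by apply/mnmP => i; rewrite mnmDE; case: (ord3P i) => ->; rewrite !xyzE. Qed.

Lemma mnm1x : (U_(ox) = xyz 1 0 0)%MM.
Proof. by apply/mnmP => i; rewrite mnm1E; case: (ord3P i) => ->; rewrite xyzE. Qed.
Lemma mnm1y : (U_(oy) = xyz 0 1 0)%MM.
Proof. by apply/mnmP => i; rewrite mnm1E; case: (ord3P i) => ->; rewrite xyzE. Qed.
Lemma mnm1z : (U_(oz) = xyz 0 0 1)%MM.
Proof. by apply/mnmP => i; rewrite mnm1E; case: (ord3P i) => ->; rewrite xyzE. Qed.

Lemma mdeg_xyz a b c : mdeg (xyz a b c) = (a + b + c)%N.
Proof.
rewrite mdegE !big_ord_recl big_ord0 addn0 addnA.
by congr (_ + _ + _)%N; rewrite mnmE.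
Qed.

(* [hxy n p] homogenizes [p] in the variables x, y to degree [n - 1]. *)
Definition hxy (R : comNzRingType) (n : nat) (p : {poly R}) : {mpoly R[3]} :=
  \sum_(k < n) p`_k *: 'X_[xyz (n.-1 - k) k 0].

Section Hxy.
Variable R : comNzRingType.
Implicit Types (n : nat) (p q : {poly R}).

Lemma hxyD n p q : hxy n (p + q) = hxy n p + hxy n q.
Proof. by rewrite -big_split; apply: eq_bigr => k _; rewrite coefD scalerDl. Qed.

Lemma hxyZ n c p : hxy n (c *: p) = c *: hxy n p.
Proof. by rewrite scaler_sumr; apply: eq_bigr => k _; rewrite coefZ scalerA. Qed.

Lemma hxy0 n : hxy n (0 : {poly R}) = 0.
Proof. by rewrite -(scale0r (0 : {poly R})) hxyZ scale0r. Qed.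

Lemma hxy_mulX n p : (size p <= n)%N -> 'X_ox * hxy n p = hxy n.+1 p.
Proof.
move=> sp; rewrite /hxy big_ord_recr /= nth_default // scale0r addr0 mulr_sumr.
apply: eq_bigr => -[k lkn] _; rewrite -scalerAr -mpolyXD mnm1x xyzD.
by congr (_ *: 'X_[xyz _ _ _]) => /=; lia.
Qed.

Lemma hxy_mulY n p : (size p <= n)%N -> 'X_oy * hxy n p = hxy n.+1 ('X * p).
Proof.
move=> sp; rewrite /hxy big_ord_recl coefXM eqxx scale0r add0r mulr_sumr.
apply: eq_bigr => -[k lkn] _; rewrite -scalerAr -mpolyXD mnm1y xyzD.
rewrite coefXM /= /bump add1n /=.
by congr (_ *: 'X_[xyz _ _ _]) => /=; lia.
Qed.

Lemma hxy_mul_linear n p t : (size p <= n)%N ->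
  ('X_ox + t *: 'X_oy) * hxy n p = hxy n.+1 ((1 + t *: 'X) * p).
Proof.
move=> sp; rewrite mulrDl mulrDl mul1r hxyD hxy_mulX // -scalerAl hxy_mulY //.
by rewrite -scalerAl hxyZ.
Qed.

Lemma size_linear_exp_mul n p (t : R) a : (size p <= n)%N ->
  (size (p * (1 + t *: 'X) ^+ a)%R <= n + a)%N.
Proof.
move=> sp; elim: a => [|a IH]; first by rewrite mulr1 addn0.
rewrite exprSr mulrA mulrDr mulr1 addnS; apply: leq_trans (size_polyD _ _) _.
rewrite geq_max (leq_trans IH) //= -scalerAr.
apply: leq_trans (size_scale_leq _ _) _.
by apply: leq_trans (size_polyMleq _ _) _; rewrite size_polyX addn2.
Qed.

(** The binomial expansion of the power of [(x + ty) + cz], truncated modulo [z^2]. *)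
Lemma hxy_mul_exp n p (t c : R) a : (size p <= n)%N -> exists w,
  ('X_ox + t *: 'X_oy + c *: 'X_oz) ^+ a * hxy n p =
  hxy (n + a) (p * (1 + t *: 'X) ^+ a) +
  'X_oz * (c *: (hxy (n + a.-1) (p * (1 + t *: 'X) ^+ a.-1) *+ a)) + 'X_oz ^+ 2 * w.
Proof.
move=> sp; elim: a => [|a [w IH]].
  by exists 0; rewrite expr0 mul1r mulr1 !addn0 mulr0n scaler0 mulr0 mulr0 !addr0.
pose l : {mpoly R[3]} := 'X_ox + t *: 'X_oy.
pose u b := hxy (n + b) (p * (1 + t *: 'X) ^+ b).
have lu b : l * u b = u b.+1.
  by rewrite /l hxy_mul_linear ?size_linear_exp_mul // /u addnS mulrCA -exprS.
have lV : l * (u a.-1 *+ a) = u a *+ a.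
  by case: (a) => [|b]; rewrite ?mulr0n ?mulr0 // mulrnAr lu.
exists (c *: (c *: (u a.-1 *+ a)) + (l + c *: 'X_oz) * w).
rewrite exprS -mulrA IH -/l -/(u a) -/(u a.-1) -/(u a.+1) /= -/(u a).
rewrite -lu mulrSr -lV.
move: (u a.-1 *+ a) (u a) => V U; clear lu lV IH; clearbody l.
by rewrite -!mul_mpolyC; ring.
Qed.

Lemma mcoeff_hxy n p m : (hxy n p)@_m = \sum_(k < n) p`_k * (m == xyz (n.-1 - k) k 0)%:R.
Proof.
by rewrite /hxy raddf_sum; apply: eq_bigr => k _ /=; rewrite mcoeffZ mcoeffX eq_sym.
Qed.

Lemma mcoeff_hxy_xyz n p (k : 'I_n) : (hxy n p)@_(xyz (n.-1 - k) k 0) = p`_k.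
Proof.
rewrite mcoeff_hxy (bigD1 k) //= eqxx mulr1 big1 ?addr0 // => i /negPf ik.
by rewrite xyz_eq (eq_sym (k : nat)) -val_eqE in ik *; rewrite ik andbF mulr0.
Qed.

Lemma mcoeff_hxy_z n p a b c : (hxy n p)@_(xyz a b c.+1) = 0.
Proof. by rewrite mcoeff_hxy big1 // => i _; rewrite xyz_eq !andbF mulr0. Qed.

Lemma mcoeff_mulZ (f : {mpoly R[3]}) a b c : ('X_oz * f)@_(xyz a b c.+1) = f@_(xyz a b c).
Proof.
have -> : xyz a b c.+1 = (U_(oz) + xyz a b c)%MM by rewrite mnm1z xyzD.
by rewrite mulrC mcoeffMX.
Qed.

Lemma mcoeff_mulZ0 (f : {mpoly R[3]}) a b : ('X_oz * f)@_(xyz a b 0) = 0.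
Proof.
rewrite [f]mpolyE mulr_sumr raddf_sum big1 // => m _ /=.
rewrite -scalerAr -mpolyXD mcoeffZ mcoeffX [m]xyz_eta mnm1z xyzD xyz_eq !andbF.
by rewrite mulr0.
Qed.
End Hxy.

(** * The coefficient matrix *)

Lemma row_full_inj_col (K : fieldType) (p q : nat) (A : 'M[K]_(p, q)) :
  (forall u : 'cV_q, A *m u = 0 -> u = 0) -> row_full A.
Proof.
move=> Au; rewrite -cokermx_eq0; apply/eqP/matrixP => i k.
have := Au (col k (cokermx A)); rewrite colE mulmxA mulmx_coker mul0mx => /(_ erefl).
by move/matrixP/(_ i 0); rewrite -colE !mxE.
Qed.

Section CoefMatrix.
Variables (N : nat) (a : 'I_N -> nat) (j : nat).

(** Monomials of degree [j - 2], bounded to give a finite type; writing [+ 2] makes it empty when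
    [j < 2]. *)
Definition cofactor_mon := {m : 'X_{1..3 < j.+1} | mdeg m + 2 == j}%N.
(** The two ordinals index monomials in [x, y] of degrees [j - a i] and [j - a i - 1]. Truncated
    subtraction leaves both empty when [a i > j]. *)
Definition row_idx := ({i : 'I_N & 'I_(j.+1 - a i) + 'I_(j - a i)} + cofactor_mon)%type.
(** Monomials of degree [j], sorted by exponent of [z]: 0, 1, at least 2. *)
Definition col_idx := ('I_j.+1 + 'I_j + cofactor_mon)%type.

(* For a fixed [i] the [inl] rows are [l i ^+ a i] times a basis of a complement of the
   multiples of [L ^+ 2] in degree [j - a i]. *)
Definition row_poly (R : comNzRingType) (l : 'I_N -> {mpoly R[3]}) (L : {mpoly R[3]})
    (r : row_idx) : {mpoly R[3]} :=
  match r with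
  | inl (existT i (inl k)) => 'X_[xyz ((j.+1 - a i).-1 - k) k 0] * l i ^+ a i
  | inl (existT i (inr k)) => 'X_[xyz ((j - a i).-1 - k) k 0] * (L * l i ^+ a i)
  | inr m => 'X_[bmnm (val m)] * L ^+ 2
  end.

Definition col_mon (c : col_idx) : 'X_{1..3} :=
  match c with
  | inl (inl k) => xyz (j - k) k 0
  | inl (inr k) => xyz (j.-1 - k) k 1
  | inr m => (bmnm (val m) + xyz 0 0 2)%MM
  end.

(** Keeping the multiples of [L ^+ 2] as rows avoids the quotient by [L ^+ 2], so the entries are
    polynomial in the coefficients of the forms. *)
Definition coef_mx (R : comNzRingType) (l : 'I_N -> {mpoly R[3]}) (L : {mpoly R[3]}) :=
  \matrix_(r < #|{: row_idx}|, c < #|{: col_idx}|)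
    (row_poly l L (enum_val r))@_(col_mon (enum_val c)).

(** Used to obtain the matrix at each point by evaluating one generic matrix. *)
Lemma map_coef_mx (R S : comNzRingType) (f : {rmorphism R -> S}) l L :
  map_mx f (coef_mx l L) = coef_mx (fun i => map_mpoly f (l i)) (map_mpoly f L).
Proof.
apply/matrixP => r c; rewrite !mxE -mcoeff_map_mpoly; congr (_@__).
by case: (enum_val r) => [[i [k|k]]|m] /=; rewrite !(rmorphM, rmorphXn) /= map_mpolyX.
Qed.

Lemma card_row_idx :
  #|{: row_idx}| = (\sum_i ((j.+1 - a i) + (j - a i)) + #|{: cofactor_mon}|)%N.
Proof.
rewrite card_sum card_tagged sumnE big_map big_enum /=; congr (_ + _)%N.
by apply: eq_bigr => i _; rewrite card_sum !card_ord.
Qed.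

Lemma card_col_idx : #|{: col_idx}| = (j.+1 + j + #|{: cofactor_mon}|)%N.
Proof. by rewrite !card_sum !card_ord. Qed.

Lemma bmnm_val_inj : injective (fun m : cofactor_mon => bmnm (val m)).
Proof. by move=> m m' E; apply: val_inj; apply: val_inj. Qed.

Lemma col_mon_inj : injective col_mon.
Proof.
have ne (m m' : 'X_{1..3}) : m oz <> m' oz -> m = m' -> False by move=> + E; rewrite E.
have z2 (m : 'X_{1..3}) : (m + xyz 0 0 2)%MM oz = (m oz).+2.
  by rewrite mnmDE xyzE addn2.
move=> [[k|k]|m] [[k'|k']|m'] /= E.
- by move/eqP: E; rewrite xyz_eq => /and3P[_ /eqP/val_inj->].
- by case: (ne _ _ _ E); rewrite !xyzE.
- by case: (ne _ _ _ E); rewrite z2 !xyzE.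
- by case: (ne _ _ _ E); rewrite !xyzE.
- by move/eqP: E; rewrite xyz_eq => /and3P[_ /eqP/val_inj->].
- by case: (ne _ _ _ E); rewrite z2 !xyzE.
- by case: (ne _ _ _ E); rewrite z2 !xyzE.
- by case: (ne _ _ _ E); rewrite z2 !xyzE.
by move/addIm: E => /bmnm_val_inj->.
Qed.

Lemma col_monP (m : 'X_{1..3}) : mdeg m = j -> exists c, col_mon c = m.
Proof.
move=> mj; move: (mj); rewrite [m]xyz_eta mdeg_xyz => md.
case: (posnP (m oz)) => [z0|].
  have h : (m oy < j.+1)%N by lia.
  by exists (inl (inl (Ordinal h))) => /=; rewrite z0; congr xyz; lia.
rewrite -[(0 < _)%N]/(1 <= _)%N leq_eqVlt => /orP[/eqP z1|z2].
  have h : (m oy < j)%N by lia.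
  by exists (inl (inr (Ordinal h))) => /=; rewrite -z1; congr xyz; lia.
pose m' := xyz (m ox) (m oy) (m oz - 2).
have h : (mdeg m' < j.+1)%N by rewrite mdeg_xyz; lia.
have h' : (mdeg (BMultinom h) + 2 == j)%N by rewrite /= mdeg_xyz; apply/eqP; lia.
exists (inr (exist _ (BMultinom h) h')) => /=; rewrite /m' xyzD !addn0.
by congr xyz; lia.
Qed.
End CoefMatrix.

(** * The matrix at the special point [L = z] *)

Section SpecialPoint.
Variables (K : fieldType) (hK : [pchar K] =i pred0).
Variables (N : nat) (a : 'I_N -> nat) (m : nat) (t : 'I_N -> K).
Hypothesis tI : injective t.
Hypothesis a0 : forall i, (0 < a i)%N.
Let D := (\sum_i (m.+1 - a i))%N.
Let eps := (m.+1 - D)%N.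
Hypothesis hc : (m.+1 < D)%N \/ (eps.*2 < #|[pred i | a i <= m.+1]|)%N.

(** A vector in the right kernel is a functional on forms of degree [m + 1] killing all row
    polynomials; [fat_points_functional_eq0] shows that it is zero. *)
Lemma special_row_full :
  row_full (coef_mx a m.+1
    (fun i => 'X_ox + t i *: 'X_oy + t i ^+ eps.+1 *: 'X_oz : {mpoly K[3]}) 'X_oz).
Proof.
pose l (i : 'I_N) : {mpoly K[3]} := 'X_ox + t i *: 'X_oy + t i ^+ eps.+1 *: 'X_oz.
change (row_full (coef_mx a m.+1 l 'X_oz)).
apply: row_full_inj_col => u Mu.
pose lam (c : col_idx m.+1) := u (enum_rank c) 0.
pose ev (f : {mpoly K[3]}) := \sum_(c : col_idx m.+1) f@_(col_mon c) * lam c.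
have ev_row (r : row_idx a m.+1) : ev (row_poly l 'X_oz r) = 0.
  have := congr1 (fun A : 'cV_#|{: row_idx a m.+1}| => A (enum_rank r) 0) Mu.
  rewrite !mxE => <-.
  rewrite /ev (reindex (fun c : 'I_#|{: col_idx m.+1}| => enum_val c)) /=.
    2: exact/onW_bij/enum_val_bij.
  by apply: eq_bigr => c _; rewrite mxE enum_rankK /lam enum_valK.
have ev_sum n (p : 'I_n -> K) F : ev (\sum_(k < n) p k *: F k) = \sum_(k < n) p k * ev (F k).
  rewrite /ev; under [in RHS]eq_bigr do rewrite mulr_sumr.
  rewrite exchange_big; apply: eq_bigr => c _; rewrite raddf_sum mulr_suml.
  by apply: eq_bigr => k _ /=; rewrite mcoeffZ mulrA.
(* For [L = z] the cofactor rows are the monomials divisible by [z^2], so only the values [al] and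
   [be] remain. *)
have lamT (w : cofactor_mon m.+1) : lam (inr w) = 0.
  have <- : ev 'X_[col_mon (inr w)] = lam (inr w).
    rewrite /ev (bigD1 (inr w)) //= mcoeffX eqxx mul1r big1 ?addr0 // => c cw.
    rewrite mcoeffX; case: eqP => [E|]; last by rewrite mul0r.
    by move: cw; rewrite (@col_mon_inj _ (inr w) c E) eqxx.
  have <- := ev_row (inr w); congr ev => /=.
  by rewrite mpolyXn -mpolyXD; congr ('X_[_ + _]); apply/mnmP => i; rewrite mnm1z mulmnE;
  case: (ord3P i) => ->; rewrite !xyzE.
pose al k := lam (inl (inl (inord k))); pose be k := lam (inl (inr (inord k))).
have evE f : ev f = \sum_(k < m.+2) f@_(xyz (m.+1 - k) k 0) * al k
                  + \sum_(k < m.+1) f@_(xyz (m - k) k 1) * be k.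
  rewrite /ev !big_sumType /= [X in _ + X]big1 ?addr0 => [|w _]; last by rewrite lamT mulr0.
  by congr (_ + _); apply: eq_bigr => k _; rewrite /al /be inord_val.
have ev_form p q c e w :
    ev (hxy m.+2 p + 'X_oz * (c *: (hxy m.+1 q *+ e)) + 'X_oz ^+ 2 * w) =
    cpair al m.+2 p + c * cpair be m.+1 q *+ e.
  rewrite evE /cpair -mulrnAr -[in RHS]sumrMnl [in RHS]mulr_sumr.
  congr (_ + _); apply: eq_bigr => k _.
    rewrite !mcoeffD mcoeff_mulZ0 expr2 -mulrA mcoeff_mulZ0 !addr0.
    by rewrite (mcoeff_hxy_xyz p k) mulrC.
  rewrite !mcoeffD mcoeff_hxy_z mcoeff_mulZ expr2 -mulrA mcoeff_mulZ mcoeff_mulZ0.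
  rewrite add0r addr0 mcoeffZ mcoeffMn (mcoeff_hxy_xyz q k).
  by rewrite -mulrA mulrnAl (mulrC q`_k).
have ev1 i p : ev (l i ^+ a i * hxy (m.+2 - a i) p) = 0.
  rewrite mulr_sumr; under eq_bigr do rewrite -scalerAr.
  rewrite ev_sum big1 // => k _.
  by have := ev_row (inl (existT _ i (inl k))); rewrite /= mulrC => ->; rewrite mulr0.
have ev2 i p : ev (l i ^+ a i * hxy (m.+1 - a i) p * 'X_oz) = 0.
  rewrite mulr_sumr mulr_suml; under eq_bigr do rewrite -scalerAr -scalerAl.
  rewrite ev_sum big1 // => k _.
  have := ev_row (inl (existT _ i (inr k))) => /=; rewrite mulrCA mulrC.
  by rewrite [_ * l i ^+ _]mulrC => ->; rewrite mulr0.
(* Indices with [a i > m.+1] contribute zero to [D]. *)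
have DP : (\sum_(i | (a i <= m.+1)%N) (m.+1 - a i))%N = D.
  rewrite /D [in RHS](bigID (fun i => a i <= m.+1)%N) /= [X in (_ + X)%N]big1 ?addn0 //.
  by move=> i; rewrite -ltnNge => /ltnW; rewrite -subn_eq0 => /eqP.
have := @fat_points_functional_eq0 K hK _ (fun i => a i <= m.+1)%N t
  (fun i => m.+1 - a i)%N m al be tI.
rewrite DP -/eps => /(_ _ hc) [].
- by move=> i; have := a0 i; lia.
- move=> i /= ai p sp; have ai0 := a0 i.
  have [|w] := @hxy_mul_exp _ (m.+2 - a i) p (t i) (t i ^+ eps.+1) (a i).
    by apply: leq_trans sp _; lia.
  have -> : (m.+2 - a i + a i = m.+2)%N by lia.
  have -> : (m.+2 - a i + (a i).-1 = m.+1)%N by lia.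
  have -> : (m.+1 - (m.+1 - a i) = a i)%N by lia.
  have -> : (m - (m.+1 - a i) = (a i).-1)%N by lia.
  by move/(congr1 ev); rewrite -/(l i) ev1 ev_form => <-.
- move=> i /= ai p sp; have ai0 := a0 i.
  have [|w] := @hxy_mul_exp _ (m.+1 - a i) p (t i) (t i ^+ eps.+1) (a i); first exact: sp.
  have -> : (m.+1 - a i + a i = m.+1)%N by lia.
  have -> : (m.+1 - (m.+1 - a i) = a i)%N by lia.
  move/(congr1 (fun f => ev (f * 'X_oz))); rewrite -/(l i) ev2 => E.
  set q := p * _ in E *; set V := _ *+ a i in E.
  (* The extra factor [z] sends the linear term in [z] into the multiples of [z^2], leaving only the
     pairing with [be]. *)
  have := ev_form 0 q 1 1%N (t i ^+ eps.+1 *: V + 'X_oz * w).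
  rewrite /cpair big1 => [|k _]; last by rewrite coef0 mulr0.
  rewrite add0r mul1r !mulr1n => <-; rewrite E; congr ev.
  by rewrite hxy0 scale1r -!mul_mpolyC; ring.
move=> al0 be0; apply/matrixP => c k; rewrite ord1 [RHS]mxE -[c]enum_valK.
rewrite -/(lam (enum_val c)).
case: (enum_val c) => [[n|n]|w]; last exact: lamT.
  by rewrite -[n]inord_val; apply: al0; rewrite -ltnS.
by rewrite -[n]inord_val; apply: be0; rewrite -ltnS.
Qed.
End SpecialPoint.

(** * Division by the square of a linear form *)

Lemma mpolyX_succ (R : comNzRingType) (n d : nat) (m : 'X_{1..n}) : mdeg m = d.+1 ->
  exists i m', mdeg m' = d /\ 'X_[m] = 'X_i * 'X_[m'] :> {mpoly R[n]}.
Proof.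
move=> md; have [i mi] : exists i, (0 < m i)%N.
  apply/existsP; apply: contraT; rewrite negb_exists => /forallP m0.
  suff m0' : mdeg m = 0%N by rewrite m0' in md.
  by rewrite mdegE; apply: big1 => i _; case: (m i) (m0 i).
have le_im : (U_(i) <= m)%MM.
  by apply/mnm_lepP => k; rewrite mnm1E; case: eqP => // <-.
exists i, (m - U_(i))%MM; split; last by rewrite -mpolyXD addmC submK.
by apply: succn_inj; rewrite -md -[in RHS](submK le_im) mdegD mdeg1 addn1.
Qed.

Lemma dhomog_ind (R : comNzRingType) (n d : nat) (P : {mpoly R[n]} -> Prop) :
  P 0 -> (forall f g, P f -> P g -> P (f + g)) -> (forall c f, P f -> P (c *: f)) ->
  (forall m, mdeg m = d -> P 'X_[m]) -> forall f, f \is d.-homog -> P f.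
Proof.
move=> P0 PD PZ PX f /dhomogP hf; rewrite [f]mpolyE big_seq.
by apply: (big_ind P) => // m mf; apply/PZ/PX/hf.
Qed.

(** This allows cofactors in an ideal membership to be replaced by homogeneous ones. *)
Lemma pihomogM (R : comNzRingType) (n e d : nat) (g G : {mpoly R[n]}) :
  G \is e.-homog ->
  pihomog mdeg d (g * G) = if (e <= d)%N then pihomog mdeg (d - e) g * G else 0.
Proof.
move=> hG; rewrite {1}[g]mpolyE mulr_suml raddf_sum /=.
have E m : pihomog mdeg d (g@_m *: 'X_[m] * G) =
    if (mdeg m + e == d)%N then g@_m *: 'X_[m] * G else 0.
  have h : 'X_[m] * G \is (mdeg m + e).-homog by apply: dhomogM; rewrite ?dhomogX.
  rewrite -scalerAl linearZ /=; case: eqP => [<-|/eqP ne].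
    by rewrite pihomog_dE.
  by rewrite (pihomog_ne0 ne) ?scaler0.
under eq_bigr do rewrite E.
case: leqP => [le_ed|lt_de]; last by rewrite big1 // => m _; case: eqP => // ?; lia.
rewrite pihomogE mulr_suml [RHS]big_mkcond /=; apply: eq_bigr => m _.
by congr (if _ then _ else _); apply/eqP/eqP; lia.
Qed.

Section Division.
Variables (K : fieldType) (c : 'I_3 -> K) (cz : c oz != 0).
Let L := linform c.

Let quotient d (f : {mpoly K[3]}) :=
  exists (p q : {poly K}) (h : {mpoly K[3]}),
    [/\ (size p <= d.+1)%N, (size q <= d)%N &
      f = hxy d.+1 p + L * hxy d q + L ^+ 2 * h].

(** As [c oz] is nonzero, [z] is a combination of [x], [y], [L], so a form can be expanded in powers
    of [L]. The induction multiplies by one variable at a time. *)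
Lemma divide_sqr (d : nat) (f : {mpoly K[3]}) : f \is d.-homog -> quotient d f.
Proof.
elim: d f => [|d IH]; apply: dhomog_ind; try by
  [ exists 0, 0, 0; rewrite size_poly0 !hxy0 !mulr0 !addr0
  | move=> _ _ [p [q [h [sp sq ->]]]] [p' [q' [h' [sp' sq' ->]]]];
    exists (p + p'), (q + q'), (h + h'); split;
      [ by rewrite (leq_trans (size_polyD _ _)) // geq_max sp
      | by rewrite (leq_trans (size_polyD _ _)) // geq_max sq
      | by rewrite !hxyD; ring ]
  | move=> e _ [p [q [h [sp sq ->]]]]; exists (e *: p), (e *: q), (e *: h); split;
      [ exact: leq_trans (size_scale_leq _ _) sp
      | exact: leq_trans (size_scale_leq _ _) sq
      | by rewrite !hxyZ !scalerDr !scalerAr ] ].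
  move=> m /eqP; rewrite mdeg_eq0 => /eqP->; exists 1, 0, 0.
  rewrite size_poly1 size_poly0 hxy0 !mulr0 !addr0; split=> //.
  rewrite /hxy big_ord_recl big_ord0 coef1 scale1r addr0; congr ('X_[_]).
  by apply/mnmP => i; rewrite mnm0E; case: (ord3P i) => ->; rewrite xyzE.
move=> m md; have [i [m' [md' ->]]] := mpolyX_succ K md.
have [|p [q [h [sp sq ->]]]] := IH 'X_[m']; first by rewrite dhomogX /= md'.
have sX n (r : {poly K}) : (size r <= n -> size ('X * r)%R <= n.+1)%N.
  move=> sr; apply: leq_trans (size_polyMleq _ _) _.
  by rewrite size_polyX.
case: (ord3P i) => ->.
- exists p, q, ('X_ox * h); split; [exact: leqW | exact: leqW |].
  by rewrite -(hxy_mulX sp) -(hxy_mulX sq); ring.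
- exists ('X * p), ('X * q), ('X_oy * h); split; [exact: sX | exact: sX |].
  by rewrite -(hxy_mulY sp) -(hxy_mulY sq); ring.
(* The witnesses come from replacing [z] by [(L - c_x x - c_y y) / c_z] in [z p + z L q] and sorting
   by powers of [L]. *)
exists (- (c oz)^-1 *: (c ox *: p + c oy *: ('X * p))),
  ((c oz)^-1 *: (p + (- c ox) *: q + (- c oy) *: ('X * q))),
  ((c oz)^-1 *: hxy d q + 'X_oz * h); split.
- apply: leq_trans (size_scale_leq _ _) _; apply: leq_trans (size_polyD _ _) _.
  rewrite geq_max !(leq_trans (size_scale_leq _ _)) //; first exact: sX.
  exact: leqW.
- apply: leq_trans (size_scale_leq _ _) _; apply: leq_trans (size_polyD _ _) _.
  rewrite geq_max (leq_trans (size_scale_leq _ _)) ?sX // andbT.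
  apply: leq_trans (size_polyD _ _) _; rewrite geq_max sp.
  by apply: leq_trans (size_scale_leq _ _) _; apply: leqW.
rewrite !(hxyZ, hxyD) -(hxy_mulX sp) -(hxy_mulX sq) -(hxy_mulY sp) -(hxy_mulY sq).
have Z : 'X_oz = (c oz)^-1 *: (L - c ox *: 'X_ox - c oy *: 'X_oy) :> {mpoly K[3]}.
  rewrite /L linformE; apply: (scalerI cz); rewrite scalerA divff // scale1r.
  by rewrite -!mul_mpolyC; ring.
rewrite mulrDr mulrDr {1 2}Z; move: (hxy d.+1 p) (hxy d q) => P Q.
by rewrite -!mul_mpolyC !rmorphN; clearbody L; ring.
Qed.
End Division.

(** * From the rank of the matrix to multiplication by a square *)

Section RankConsequences.
Variables (K : fieldType) (N : nat) (a : 'I_N -> nat) (j : nat).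
Variables (l : 'I_N -> {mpoly K[3]}) (L : {mpoly K[3]}).
Hypotheses (hl : forall i, l i \is 1.-homog) (hL : L \is 1.-homog).

Lemma sum_row_poly (w : row_idx a j -> K) :
  \sum_r w r *: row_poly l L r =
  \sum_i (\sum_(k < j.+1 - a i) w (inl (existT _ i (inl k))) *:
            'X_[xyz ((j.+1 - a i).-1 - k) k 0] +
          L * \sum_(k < j - a i) w (inl (existT _ i (inr k))) *:
            'X_[xyz ((j - a i).-1 - k) k 0]) * l i ^+ a i +
  (\sum_(m : cofactor_mon j) w (inr m) *: 'X_[bmnm (val m)]) * L ^+ 2.
Proof.
rewrite big_sumType /=; congr (_ + _).
  transitivity (\sum_i \sum_(x : 'I_(j.+1 - a i) + 'I_(j - a i))
      w (inl (existT _ i x)) *: row_poly l L (inl (existT _ i x))).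
    by rewrite sig_big_dep /=; apply: eq_big => [[]|[i x]].
  apply: eq_bigr => i _; rewrite big_sumType /= mulrDl mulr_suml.
  congr (_ + _); first by apply: eq_bigr => k _; rewrite -scalerAl.
  rewrite mulr_sumr mulr_suml; apply: eq_bigr => k _.
  by rewrite -scalerAr -scalerAl; congr (_ *: _); ring.
by rewrite mulr_suml; apply: eq_bigr => m _; rewrite -scalerAl.
Qed.

Lemma dhomog_exp1 (f : {mpoly K[3]}) e : f \is 1.-homog -> f ^+ e \is e.-homog.
Proof. by move/(dhomogMn e); rewrite mul1n. Qed.

Lemma row_poly_homog (r : row_idx a j) : row_poly l L r \is j.-homog.
Proof.
case: r => [[i [[k hk]|[k hk]]]|[m /= /eqP hm]] /=.
- have h : 'X_[xyz ((j.+1 - a i).-1 - k) k 0] \is [in K[3], (j - a i).-homog].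
    by rewrite dhomogX /= mdeg_xyz; apply/eqP; lia.
  by have := dhomogM h (dhomog_exp1 (a i) (hl i)); rewrite subnK //; lia.
- have h : 'X_[xyz ((j - a i).-1 - k) k 0] \is [in K[3], (j - (1 + a i)).-homog].
    by rewrite dhomogX /= mdeg_xyz; apply/eqP; lia.
  by have := dhomogM h (dhomogM hL (dhomog_exp1 (a i) (hl i))); rewrite subnK //; lia.
have h : 'X_[bmnm m] \is [in K[3], (mdeg m).-homog] by rewrite dhomogX.
by have := dhomogM h (dhomog_exp1 2 hL); rewrite hm.
Qed.

Lemma cofactor_sum (F : {mpoly K[3]}) (d : nat) : j = d.+2 -> F \is d.-homog ->
  F = \sum_(m : cofactor_mon j) F@_(bmnm (val m)) *: 'X_[bmnm (val m)].
Proof.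
move=> jd hF; apply/mpolyP => m; rewrite raddf_sum /=.
under eq_bigr do rewrite mcoeffZ mcoeffX.
have [md|ne] := eqVneq (mdeg m) d; last first.
  rewrite (dhomog_nemf_coeff hF ne) big1 // => m' _; case: eqP => [E|]; last by rewrite mulr0.
  by rewrite E (dhomog_nemf_coeff hF ne) mul0r.
have h : (mdeg m < j.+1)%N by lia.
have h' : (mdeg (BMultinom h) + 2 == j)%N by rewrite /= md jd addn2.
rewrite (bigD1 (exist _ (BMultinom h) h')) //= eqxx mulr1 big1 ?addr0 // => m' ne.
case: eqP => [E|]; last by rewrite mulr0.
by case/eqP: ne; apply: bmnm_val_inj; rewrite E.
Qed.

(** The rows span all forms of degree [j]. In an expression of [h] by rows, the cofactor rows give
    [f] and the others lie in the ideal. *)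
Lemma row_full_surjective : row_full (coef_mx a j l L) -> (1 < j)%N ->
  mult_surjective (fun i => l i ^+ a i) (L ^+ 2) 2 j.
Proof.
move=> /row_fullP[B BA] j2 h /= hh.
pose b := \row_(c < #|{: col_idx j}|) h@_(col_mon (enum_val c)).
pose w (r : row_idx a j) := (b *m B) 0 (enum_rank r).
have hE : h = \sum_r w r *: row_poly l L r.
  apply/mpolyP => m; rewrite raddf_sum /=.
  have [md|ne] := eqVneq (mdeg m) j; last first.
    rewrite (dhomog_nemf_coeff hh ne) big1 // => r _.
    by rewrite mcoeffZ (dhomog_nemf_coeff (row_poly_homog r) ne) mulr0.
  have [c <-] := col_monP md.
  have : (b *m B *m coef_mx a j l L) 0 (enum_rank c) = b 0 (enum_rank c).
    by rewrite -mulmxA BA mulmx1.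
  rewrite [RHS]mxE enum_rankK => <-; rewrite mxE.
  rewrite (reindex (fun r : row_idx a j => enum_rank r)) /=; last first.
    exact/onW_bij/enum_rank_bij.
  by apply: eq_bigr => r _; rewrite [X in _ * X]mxE !enum_rankK mcoeffZ.
rewrite sum_row_poly in hE.
exists (\sum_(m : cofactor_mon j) w (inr m) *: 'X_[bmnm (val m)]).
  have [d jd] : exists d, j = d.+2 by exists (j - 2)%N; lia.
  have -> : Posz j - 2 = Posz d by rewrite jd -addn2 PoszD addrK.
  rewrite /=; apply: rpred_sum => m _; apply: dhomogZ.
  have /eqP hm := valP m.
  by rewrite dhomogX; apply/eqP/(@addIn 2); rewrite hm jd addn2.
by rewrite [h in in_ideal _ (h - _)]hE [L ^+ 2 * _]mulrC addrK; eexists.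
Qed.

(** Write [g i = p + L q + L^2 h]. The relation becomes a linear relation among the rows with
    coefficients from [p], [q] and a cofactor of [L^2], so [p] and [q] vanish. *)
Lemma row_free_kernel (c : 'I_3 -> K) (g : 'I_N -> {mpoly K[3]}) (d : nat)
    (f : {mpoly K[3]}) :
  row_free (coef_mx a j l L) -> j = d.+2 -> L = linform c -> c oz != 0 ->
  (forall i, if (a i <= j)%N then g i \is (j - a i).-homog else g i == 0) ->
  \sum_i g i * l i ^+ a i = L ^+ 2 * f -> forall i, exists h, g i = L ^+ 2 * h.
Proof.
move=> freeA jd LE cz hg gf.
have /fin_all_exists[pqh pqhE] : forall i, exists x : {poly K} * {poly K} * {mpoly K[3]},
    g i = hxy (j.+1 - a i) x.1.1 + L * hxy (j - a i) x.1.2 + L ^+ 2 * x.2.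
  move=> i; case: ifP (hg i) => [le_ai /(divide_sqr cz)|_ /eqP->].
    move=> [p [q [h [_ _ E]]]]; exists (p, q, h) => /=.
    by rewrite LE E subSn.
  by exists (0, 0, 0); rewrite /= !hxy0 !mulr0 !addr0.
pose p i := (pqh i).1.1; pose q i := (pqh i).1.2; pose h i := (pqh i).2.
pose F := f - \sum_i h i * l i ^+ a i.
(* [F] need not be known to be homogeneous; its part of degree [d] suffices, because [F * L ^+ 2]
   has degree [j]. *)
pose F' := pihomog mdeg d F.
pose w (r : row_idx a j) := match r with
  | inl (existT i (inl k)) => (p i)`_k
  | inl (existT i (inr k)) => (q i)`_k
  | inr m => - F'@_(bmnm (val m))
  end.
have w0 : \sum_r w r *: row_poly l L r = 0.
  have hS : \sum_i (hxy (j.+1 - a i) (p i) + L * hxy (j - a i) (q i)) * l i ^+ a i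
          = F * L ^+ 2.
    rewrite mulrBl [f * _]mulrC -gf mulr_suml -sumrB; apply: eq_bigr => i _.
    by rewrite pqhE -/(p i) -/(q i) -/(h i); ring.
  pose w' r := if r is inl _ then w r else 0.
  have hS' : \sum_r w' r *: row_poly l L r = F * L ^+ 2.
    rewrite sum_row_poly /= -hS [X in _ + X * _]big1 ?mul0r ?addr0 // => m _.
    by rewrite scale0r.
  have hom : F * L ^+ 2 \is j.-homog.
    by rewrite -hS'; apply: rpred_sum => r _; apply/dhomogZ/row_poly_homog.
  have FF' : F * L ^+ 2 = F' * L ^+ 2.
    rewrite -[LHS](pihomog_dE hom) (pihomogM _ _ (dhomog_exp1 2 hL)) jd /=.
    by rewrite subSS subSS subn0.
  rewrite sum_row_poly /= -/(hxy _ _) hS FF'.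
  rewrite [F' in F' * _ + _](cofactor_sum jd (pihomogP _ _ _)) -mulrDl -big_split /=.
  by rewrite big1 ?mul0r // => m _; rewrite scaleNr addrN.
have wr0 r : w r = 0.
  pose u := \row_x w (enum_val (x : 'I_#|{: row_idx a j}|)).
  have : u *m coef_mx a j l L = 0.
    apply/matrixP => i0 x; rewrite !mxE.
    have := congr1 (mcoeff (col_mon (enum_val x))) w0.
    rewrite mcoeff0 raddf_sum /= => E; rewrite -[RHS]E.
    rewrite [RHS](reindex (fun r : 'I_#|{: row_idx a j}| => enum_val r)) /=; last first.
      exact/onW_bij/enum_val_bij.
    by apply: eq_bigr => y _; rewrite !mxE mcoeffZ.
  move=> uA0; have u0 : u = 0 by apply: (row_free_inj freeA); rewrite uA0 mul0mx.
  have := congr1 (fun M : 'rV_#|{: row_idx a j}| => M 0 (enum_rank r)) u0.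
  by rewrite !mxE enum_rankK.
move=> i; exists (h i); rewrite pqhE -/(h i) /hxy !big1 ?mulr0 ?addr0 ?add0r // => k _.
  by have := wr0 (inl (existT _ i (inr k))) => /= ->; rewrite scale0r.
by have := wr0 (inl (existT _ i (inl k))) => /= ->; rewrite scale0r.
Qed.
End RankConsequences.

(** If [L^2 f] lies in the ideal, its cofactors, made homogeneous and extended by zero on the [E]
    extra forms, are divisible by [L^2], which then cancels. *)
Lemma row_free_injective (K : fieldType) (s E : nat) (a : 'I_(s + E) -> nat) (j : nat)
    (l : 'I_(s + E) -> {mpoly K[3]}) (c : 'I_3 -> K) :
  (forall i, l i \is 1.-homog) -> linform c \is 1.-homog -> c oz != 0 ->
  row_free (coef_mx a j l (linform c)) -> (1 < j)%N ->
  mult_injective (fun i : 'I_s => l (lshift E i) ^+ a (lshift E i)) (linform c ^+ 2) 2 j.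
Proof.
move=> hl hL cz freeA j2 f; case: j j2 freeA => [|[|d]] // _ freeA.
have -> : Posz d.+2 - 2 = Posz d by rewrite -addn2 PoszD addrK.
rewrite /= => hf [g gE].
have hLf : linform c ^+ 2 * f \is d.+2.-homog.
 exact: (dhomogM (dhomog_exp1 2 hL) hf).
pose g' i := if (a (lshift E i) <= d.+2)%N
             then pihomog mdeg (d.+2 - a (lshift E i)) (g i) else 0.
pose g'' (k : 'I_(s + E)) := match split k with inl i => g' i | inr _ => 0 end.
have hg k : if (a k <= d.+2)%N then g'' k \is (d.+2 - a k).-homog else g'' k == 0.
  rewrite /g''; case: splitP => [i ki|e _].
    have -> : k = lshift E i by apply: val_inj.
    by rewrite /g'; case: (a (lshift E i) <= d.+2)%N => //; exact: pihomogP.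
  by rewrite eqxx; case: ifP => // _; exact: rpred0.
have g'E : \sum_k g'' k * l k ^+ a k = \sum_i g' i * l (lshift E i) ^+ a (lshift E i).
  rewrite big_split_ord /= [X in _ + X]big1 ?addr0 => [|e _].
    apply: eq_bigr => i _.
    by rewrite /g'' -[lshift E i]/(unsplit (inl i)) unsplitK /=.
  by rewrite /g'' -[rshift s e]/(unsplit (inr e)) unsplitK mul0r.
have g'f : \sum_i g' i * l (lshift E i) ^+ a (lshift E i) = linform c ^+ 2 * f.
  rewrite -[RHS](pihomog_dE hLf) gE raddf_sum /=; apply: eq_bigr => i _.
  rewrite (pihomogM _ _ (dhomog_exp1 _ (hl _))) /g'.
  by case: ifP => // _; rewrite mul0r.
have ker := row_free_kernel hl hL freeA erefl erefl cz hg (etrans g'E g'f).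
have /fin_all_exists[h hE] : forall i : 'I_s, exists h, g' i = linform c ^+ 2 * h.
  move=> i; have := ker (lshift E i).
  by rewrite /g'' -[lshift E i]/(unsplit (inl i)) unsplitK.
have L0 : linform c != 0.
  apply: contra cz => /eqP L0; have := congr1 (mcoeff U_(oz)) L0.
  rewrite linformE mcoeff0 !mcoeffD !mcoeffZ !mcoeffXU !mulr0 !add0r eqxx mulr1.
  by move->.
exists h; apply: (mulfI (expf_neq0 2 L0)); rewrite -g'f mulr_sumr.
by apply: eq_bigr => i _; rewrite hE mulrA.
Qed.

(** Every monomial of degree [j + 1] is a variable times one of degree [j]; multiply the solution
    for the latter by that variable. *)
Lemma mult_surjective_succ (K : fieldType) (s : nat) (G : 'I_s -> {mpoly K[3]})
    (M : {mpoly K[3]}) (j : nat) : (1 < j)%N ->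
  mult_surjective G M 2 j -> mult_surjective G M 2 j.+1.
Proof.
move=> j2 surj; have [d jd] : exists d, j = d.+2 by exists (j - 2)%N; lia.
have e1 : Posz j - 2 = Posz d by rewrite jd -addn2 PoszD addrK.
have e2 : Posz j.+1 - 2 = Posz d.+1 by rewrite jd -addn2 PoszD addrK.
rewrite /mult_surjective e1 /= in surj; rewrite /mult_surjective e2 /=.
apply: (dhomog_ind (P := fun h => exists2 f, f \is d.+1.-homog & in_ideal G (h - M * f))).
- exists 0; first exact: rpred0.
  exists (fun _ => 0); rewrite mulr0 subr0 big1 // => i _; exact: mul0r.
- move=> h h' [f hf [g E]] [f' hf' [g' E']]; exists (f + f'); first exact: rpredD.
  exists (fun i => g i + g' i).
  under eq_bigr do rewrite mulrDl.
  by rewrite big_split /= -E -E'; ring.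
- move=> c h [f hf [g E]]; exists (c *: f); first exact: dhomogZ.
  exists (fun i => c *: g i).
  under eq_bigr do rewrite -scalerAl.
  by rewrite -scaler_sumr -E -scalerAr scalerBr.
move=> m /(mpolyX_succ K)[i [m' [md' ->]]].
have [|f hf [g E]] := surj 'X_[m']; first by rewrite dhomogX /= md'.
exists ('X_i * f).
  have hX : 'X_i \is [in K[3], 1.-homog] by rewrite dhomogX /= mdeg1.
  exact: dhomogM hX hf.
exists (fun k => 'X_i * g k).
under eq_bigr do rewrite -mulrA.
by rewrite -mulr_sumr -E; ring.
Qed.

Lemma linform_homog (K : fieldType) (c : 'I_3 -> K) : linform c \is 1.-homog.
Proof. by apply: rpred_sum => k _; apply: dhomogZ; rewrite dhomogX /= mdeg1. Qed.

Lemma eq_coef_mx (R : comNzRingType) (N : nat) (a : 'I_N -> nat) (j : nat)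
    (l l' : 'I_N -> {mpoly R[3]}) (L L' : {mpoly R[3]}) :
  l =1 l' -> L = L' -> coef_mx a j l L = coef_mx a j l' L'.
Proof.
move=> ll' ->; apply/matrixP => r c; rewrite !mxE; congr (_@__).
by case: (enum_val r) => [[i [k|k]]|m] //=; rewrite ll'.
Qed.

(** * Maximal rank at a general point *)

Section MaximalRank.
Variables (K : fieldType) (hK : [pchar K] =i pred0).
Variables (s : nat) (a : 'I_s -> nat) (ha : forall i, (0 < a i)%N).

Let nv := (s.+1 * 3)%N.
Let Lf (v : 'I_nv -> K) (i : 'I_s.+1) := linform (fun k => v (mxvec_index i k)).
Let lf v (i : 'I_s) := Lf v (widen_ord (leqnSn s) i).

Section Degree.
Variable m : nat.
Let j := m.+1.
Let D := (\sum_i (j - a i))%N.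
Let eps := (j - D)%N.
Let r := #|[pred i | a i <= j]|%N.
(** The number of points missing from the count [2 eps < r] required in [special_row_full]. *)
Let E := (eps.*2.+1 - r)%N.

(* The extra [E] fixed forms, with exponent [j], make the matrix square
   when the map is expected to be injective. *)
Let a' (i : 'I_(s + E)) := match split i with inl i => a i | inr _ => j end.
Let t (i : 'I_(s + E)) : K := (i : nat)%:R.
Let special (i : 'I_(s + E)) : {mpoly K[3]} :=
  'X_ox + t i *: 'X_oy + t i ^+ eps.+1 *: 'X_oz.
Let l' v (i : 'I_(s + E)) : {mpoly K[3]} :=
  match split i with inl i => lf v i | inr e => special (rshift s e) end.

Let a'l i : a' (lshift E i) = a i.
Proof. by rewrite /a' -[lshift E i]/(unsplit (inl i)) unsplitK. Qed.
Let a'r e : a' (rshift s e) = j.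
Proof. by rewrite /a' -[rshift s e]/(unsplit (inr e)) unsplitK. Qed.
Let l'l v i : l' v (lshift E i) = lf v i.
Proof. by rewrite /l' -[lshift E i]/(unsplit (inl i)) unsplitK. Qed.
Let l'r v e : l' v (rshift s e) = special (rshift s e).
Proof. by rewrite /l' -[rshift s e]/(unsplit (inr e)) unsplitK. Qed.

Let l'_homog v i : l' v i \is 1.-homog.
Proof.
rewrite /l'; case: (split i) => [i'|e]; first exact: linform_homog.
by rewrite !rpredD // ?dhomogZ // dhomogX /= mdeg1.
Qed.

(** An extra form has [j - a' = 0]: it raises the number of points and leaves [D] unchanged. *)
Let D' : (\sum_i (j - a' i))%N = D.
Proof.
rewrite big_split_ord /= [X in (_ + X)%N]big1 ?addn0 => [|e _]; last by rewrite a'r subnn.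
by apply: eq_bigr => i _; rewrite a'l.
Qed.

Let r' : #|[pred i | a' i <= j]|%N = (r + E)%N.
Proof.
rewrite /r -!sum1_card big_mkcond /= big_split_ord /=; congr (_ + _)%N.
  by rewrite [RHS]big_mkcond; apply: eq_bigr => i _; rewrite !inE a'l.
under eq_bigr do rewrite inE a'r leqnn.
by rewrite sum1_card card_ord.
Qed.

Lemma general_coef_mx_full :
  general (fun v => row_full (coef_mx a' j (l' v) (Lf v ord_max))).
Proof.
(* The generic forms: their coefficients are the coordinates of the parameter space. *)
pose gf (i : 'I_s.+1) : {mpoly {mpoly K[nv]}[3]} := \sum_k 'X_(mxvec_index i k) *: 'X_k.
pose gl (i : 'I_(s + E)) : {mpoly {mpoly K[nv]}[3]} := match split i with
  | inl i => gf (widen_ord (leqnSn s) i)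
  | inr e => map_mpoly (@mpolyC nv K) (special (rshift s e)) end.
have gfE v i : map_mpoly (meval v) (gf i) = Lf v i.
  rewrite rmorph_sum; apply: eq_bigr => k _.
  by rewrite /= map_mpolyZ map_mpolyX; congr (_ *: _); exact: mevalXU.
have glE v i : map_mpoly (meval v) (gl i) = l' v i.
  rewrite /gl /l'; case: (split i) => [i'|e]; first exact: gfE.
  by apply/mpolyP => x; rewrite !mcoeff_map_mpoly /= mevalC.
pose M := coef_mx a' j gl (gf ord_max).
have ME v : map_mx (meval v) M = coef_mx a' j (l' v) (Lf v ord_max).
  by rewrite map_coef_mx; apply: eq_coef_mx => [i|]; rewrite /= ?glE ?gfE.
(* The point with [L_i = x + i y + i^(eps+1) z] and [L = z], matching the extra forms. *)
pose v0 (x : 'I_nv) : K := mxvec (\matrix_(i < s.+1, k < 3)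
  if (i < s)%N then [:: 1; i%:R; i%:R ^+ eps.+1]`_k else [:: 0; 0; 1]`_k) 0 x.
apply: (general_imp (P := fun v => row_full (map_mx (meval v) M))).
  by move=> v; rewrite ME.
apply: (general_row_full (v := v0)); rewrite ME.
have -> : coef_mx a' j (l' v0) (Lf v0 ord_max) = coef_mx a' j special 'X_oz.
  apply: eq_coef_mx => [i|]; last first.
    by rewrite /Lf linformE /v0 !mxvecE !mxE /= ltnn /= !scale0r !add0r scale1r.
  rewrite -[i]splitK; case: (split i) => [i'|e] /=; last exact: l'r.
  by rewrite l'l /lf /Lf linformE /v0 !mxvecE !mxE /= ltn_ord scale1r.
have := @special_row_full K hK (s + E) a' m t; rewrite D'; apply.
- by move=> x y /(natr_inj_pchar0 hK)/val_inj.
- by move=> i; rewrite /a'; case: (split i).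
by right; rewrite r' /E; lia.
Qed.

Let max_rank v := mult_maximal_rank (fun i => lf v i ^+ a i) (Lf v ord_max ^+ 2) 2 j.
Let surj v := mult_surjective (fun i => lf v i ^+ a i) (Lf v ord_max ^+ 2) 2 j.

Lemma general_surjective : (0 < m)%N -> E = 0%N -> general surj.
Proof.
move=> m0 E0; apply: general_imp general_coef_mx_full => v fM h hh.
have [f hf [g gE]] :=
  row_full_surjective (l'_homog v) (linform_homog _) fM (m0 : (1 < j)%N) hh.
exists f => //; exists (fun i => g (lshift E i)).
rewrite gE big_split_ord /= [X in _ + X]big1 ?addr0 => [|[e he] _].
  by apply: eq_bigr => i _; rewrite l'l a'l.
by exfalso; rewrite E0 in he.
Qed.

Lemma general_max_rank : (0 < m)%N -> general max_rank.
Proof.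
move=> m0; have [E0|E0] := posnP E.
  by apply: general_imp (general_surjective m0 E0) => v; right.
(* If [D > j] then [eps = 0], so [E > 0] forces [r = 0], whence [D = 0], a contradiction. *)
have le_Dj : (D <= j)%N.
  rewrite leqNgt; apply/negP => lt_jD.
  have eps0 : eps = 0%N by rewrite /eps; lia.
  have r0 : r = 0%N by move: E0; rewrite /E eps0; lia.
  have D0 : D = 0%N.
    rewrite /D big1 // => i _; apply/eqP; rewrite subn_eq0.
    by have := card0_eq r0 i; rewrite !inE => /negbT; rewrite -ltnNge => /ltnW.
  by rewrite D0 in lt_jD.
(* Apart from cofactors there are [2 D + r + E = 2 D + 2 eps + 1 = 2 j + 1] rows, as many as
   columns. *)
have square : #|{: row_idx a' j}| = #|{: col_idx j}|.
  rewrite card_row_idx card_col_idx; congr (_ + _)%N.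
  transitivity (\sum_i (j - a' i) + (#|[pred i | a' i <= j]| + \sum_i (j - a' i)))%N.
    rewrite -sum1_card [X in (_ + (X + _))%N]big_mkcond /= -!big_split /=.
    by apply: eq_bigr => i _; rewrite inE; case: leqP; lia.
  by rewrite D' r' /E; move: E0; rewrite /E /eps; lia.
have gz : general (fun v : 'I_nv -> K => v (mxvec_index ord_max oz) != 0).
  have : ('X_(mxvec_index ord_max oz) : {mpoly K[nv]}).@[fun _ => 1] != 0.
    by rewrite mevalXU oner_eq0.
  by move/general_neq0; apply: general_imp => v; rewrite mevalXU.
apply: general_imp (general_and hK gz general_coef_mx_full) => v [cz fM]; left.
have freeM : row_free (coef_mx a' j (l' v) (Lf v ord_max)).
  by move: fM; rewrite /row_full /row_free => /eqP->; rewrite square.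
have := row_free_injective (l'_homog v) (linform_homog _) cz freeM (m0 : (1 < j)%N).
move=> inj f hf [g gE]; have [|g' g'E] := inj f hf.
  by exists g; rewrite gE; apply: eq_bigr => i _; rewrite l'l a'l.
by exists g'; rewrite g'E; apply: eq_bigr => i _; rewrite l'l a'l.
Qed.
End Degree.

Lemma general_max_rank_all : (1 < s)%N ->
  general (fun v => forall j : int,
    mult_maximal_rank (fun i => lf v i ^+ a i) (Lf v ord_max ^+ 2) 2 j).
Proof.
move=> s1; pose S := (\sum_i a i)%N; pose J := S.+1.
(* In degree [J + 1 = S + 2], [D >= s (S + 2) - S > S + 2] since [s >= 2]. So [eps = 0], and [r = s]
   gives [E = 0]. *)
have gs : general (fun v =>
    mult_surjective (fun i => lf v i ^+ a i) (Lf v ord_max ^+ 2) 2 J.+1).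
  have aS i : (a i <= S)%N by rewrite /S (bigD1 i) //= leq_addr.
  apply: general_surjective => //.
  have -> : #|[pred i | a i <= J.+1]|%N = s.
    rewrite -[RHS]card_ord; apply: eq_card => i; rewrite !inE.
    by apply: leq_trans (aS i) _; rewrite /J; lia.
  have : (s * J.+1 <= \sum_i (J.+1 - a i) + S)%N.
    rewrite /S -big_split /= -[X in (X * _)%N]card_ord -sum_nat_const.
    by apply: leq_sum => i _; lia.
  by rewrite /J; nia.
(* Only finitely many open conditions are intersected; from degree [J + 1] on, surjectivity
   propagates. *)
have gl := @general_forall_lt K hK nv (fun k v => (1 < k)%N ->
    mult_maximal_rank (fun i => lf v i ^+ a i) (Lf v ord_max ^+ 2) 2 k) J.+2.
have {}gl := gl _; apply: general_imp (general_and hK (gl _) gs) => [v [lo hi]|].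
  (* In degrees below 2 the source is zero, so the map is injective. *)
  have neg (d : int) n : d - 2 = Negz n ->
      mult_maximal_rank (fun i => lf v i ^+ a i) (Lf v ord_max ^+ 2) 2 d.
    move=> E; left => f; rewrite E /= => -> _; exists (fun _ => 0).
    by rewrite big1 // => i _; rewrite mul0r.
  case=> [j|n]; last by apply: (neg _ n.+2); rewrite !NegzE; lia.
  case: j => [|[|j]]; [exact: (neg _ 1%N) | exact: (neg _ 0%N) |].
  have [lt_jJ|le_Jj] := ltnP j.+2 J.+2; first exact: lo.
  right; rewrite -(subnKC (ltnW le_Jj)).
  elim: (j.+2 - J.+1)%N => [|k IH]; first by rewrite addn0.
  by rewrite addnS; apply: mult_surjective_succ IH; rewrite /J; lia.
case=> [|[|k]] lk; try exact: general_imp (@general_true K nv).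
by apply: general_imp (@general_max_rank k.+1 isT) => v.
Qed.
End MaximalRank.

(* Parameters: a point v of K^((s+1)*3); for i < s, L_i = linform (v (i,.)),
   and L = linform (v (s,.)). *)
Theorem theorem5p3 (K : fieldType) (hK : [pchar K] =i pred0)
    (s : nat) (hs : (3 <= s)%N) (a : 'I_s -> nat) (ha : forall i, (0 < a i)%N) :
  general (fun v : 'I_(s.+1 * 3) -> K =>
    let Lf (i : 'I_s.+1) := linform (fun k => v (mxvec_index i k)) in
    let G (i : 'I_s) := Lf (widen_ord (leqnSn s) i) ^+ a i in
    let L := Lf ord_max in
    forall j : int, mult_maximal_rank G (L ^+ 2) 2 j).
Proof.
exact: (general_max_rank_all hK ha (ltnW hs)).
Qed.
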